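(* (a) Let $A=(a_{ij})$ be an $n\times n$ w.d.d. $\mathrm{L}_0$-matrix and let $D=(d_{ij})$ be an $n\times n$ diagonal matrix whose diagonal entries are positive and satisfy $d_{ii}\le 1/a_{ii}$ for each $i$ such that $a_{ii}\ne 0$. Then $B:=I-DA$ is substochastic and $\operatorname{con}A=\widehat{\operatorname{con}}\,B$. (b) Conversely, let $B$ be an $n\times n$ substochastic matrix and $D$ be an $n\times n$ diagonal matrix whose diagonal entries are positive. Then $A:=D(I-B)$ is a w.d.d. $\mathrm{L}_0$-matrix and $\operatorname{con}A=\widehat{\operatorname{con}}\,B$.
   Context: A substochastic matrix is a real matrix $B=(b_{ij})$ with $b_{ij}\ge 0$ for all $i,j$ and $\sum_j b_{ij}\le 1$ for all $i$. An $\mathrm{L}_0$-matrix is a real matrix with nonpositive off-diagonal entries and nonnegative diagonal entries. A square complex matrix $A=(a_{ij})$ is weakly diagonally dominant (w.d.d.) if $|a_{ii}|\ge\sum_{j\ne i}|a_{ij}|$ for every $i$. The digraph of a square matrix $M=(m_{ij})$ of order $n$ has vertex set $\{1,\dots,n\}$ and an edge $i\to j$ if and only if $m_{ij}\ne0$. A walk is a nonempty finite sequence of consecutive edges $i_1\to i_2\to\cdots\to i_\ell$ ($\ell\ge2$); its length $|p|$ is the number of edges $\ell-1$. For $B$ square substochastic, let $\hat J(B)=\{i:\sum_j b_{ij}<1\}$ and let $\hat P_i(B)$ be the set of walks in the digraph of $B$ with first vertex $i$ and last vertex in $\hat J(B)$; the index of contraction is $\widehat{\operatorname{con}}\,B=\max\bigl(0,\sup_{i\notin\hat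 J(B)}\inf_{p\in\hat P_i(B)}|p|\bigr)$. For $A$ square w.d.d., let $J(A)=\{i:|a_{ii}|>\sum_{j\ne i}|a_{ij}|\}$ and let $P_i(A)$ be the set of walks in the digraph of $A$ with first vertex $i$ and last vertex in $J(A)$; the index of connectivity is $\operatorname{con}A=\max\bigl(0,\sup_{i\notin J(A)}\inf_{p\in P_i(A)}|p|\bigr)$. Conventions: $\inf\emptyset=\infty$, $\sup\emptyset=-\infty$; the suprema are over $i\in\{1,\dots,n\}$ outside the indicated set. *)

(* Defs.v *)
From mathcomp Require Import all_boot all_order all_algebra.
From mathcomp Require Import classical_sets reals ereal.

Set Implicit Arguments.
Unset Strict Implicit.
Unset Printing Implicit Defensive.

Import Order.TTheory GRing.Theory Num.Theory.

Local Open Scope classical_set_scope.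
Local Open Scope ring_scope.

Definition substochastic (R : realType) (n : nat) (B : 'M[R]_n) : Prop :=
  (forall i j, 0 <= B i j) /\ (forall i, \sum_j B i j <= 1).

Definition L0_matrix (R : realType) (n : nat) (A : 'M[R]_n) : Prop :=
  (forall i j, i != j -> A i j <= 0) /\ (forall i, 0 <= A i i).

(* Over a [numDomainType], so that complex matrices are covered as well. *)
Definition wdd (K : numDomainType) (n : nat) (A : 'M[K]_n) : Prop :=
  forall i, \sum_(j | j != i) `|A i j| <= `|A i i|.

Definition digraph (R : nmodType) (n : nat) (M : 'M[R]_n) : rel 'I_n :=
  fun i j => M i j != 0.

(* A walk from [i] is represented by the list [p] of its vertices after [i]:
   [p] is nonempty, and the number of edges of the walk is [size p]. *)
Definition walks (R : nmodType) (n : nat) (M : 'M[R]_n)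
    (J : set 'I_n) (i : 'I_n) : set (seq 'I_n) :=
  [set p | [/\ p <> [::], path (digraph M) i p & J (last i p)]].

(* [ereal_inf set0 = +oo] and [ereal_sup set0 = -oo]. *)
Definition walk_index (R : realType) (n : nat) (M : 'M[R]_n)
    (J : set 'I_n) : \bar R :=
  maxe 0%E
    (ereal_sup [set ereal_inf [set (size p)%:R%:E | p in walks M J i]
               | i in ~` J]).

Definition Jhat (R : realType) (n : nat) (B : 'M[R]_n) : set 'I_n :=
  [set i | \sum_j B i j < 1].

Definition con_hat (R : realType) (n : nat) (B : 'M[R]_n) : \bar R :=
  walk_index B (Jhat B).

Definition Jsdd (K : numDomainType) (n : nat) (A : 'M[K]_n) : set 'I_n :=
  [set i | \sum_(j | j != i) `|A i j| < `|A i i|].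

Definition con (R : realType) (n : nat) (A : 'M[R]_n) : \bar R :=
  walk_index A (Jsdd A).

(* Main.v *)
(** Off the diagonal, [A] and [B] have the same nonzero pattern, and row [i] of
    [A] is strictly dominant exactly when row [i] of [B] sums to less than [1].
    The two digraphs can thus differ only by loops; deleting the loops of a walk
    from outside the target set into it yields a nonempty walk that is no longer
    and is common to both digraphs. *)

Require Import Defs.
From mathcomp Require Import all_boot all_order all_algebra.
From mathcomp Require Import classical_sets reals ereal.

Import Order.TTheory GRing.Theory Num.Theory.

Local Open Scope ring_scope.

(** Steps from a vertex to itself are dropped, so only edges between distinct vertices must carry
    over to [e']. The result [q] is empty when [p] consists of loops alone. *)
Lemma path_deloop {T : eqType} {e e' : rel T} {x : T} {p : seq T} :
  (forall y z, y != z -> e y z -> e' y z) -> path e x p ->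
  exists q, [/\ path e' x q, last x q = last x p & (size q <= size p)%N].
Proof.
move=> ee'; elim: p x => [|y p IH] x /=; first by exists [::].
case/andP=> exy /IH [q [epq lq sq]].
have [xy|nxy] := eqVneq x y; first by exists q; rewrite xy (leqW sq).
by exists (y :: q); split=> //=; rewrite ee'.
Qed.

Section WalkIndex.
Set Implicit Arguments.
Unset Strict Implicit.
Variables (R : realType) (n : nat).
Implicit Types (M N : 'M[R]_n) (J : set 'I_n).

(** Kept one-sided, so that equality follows by exchanging [M] and [N]. *)
Lemma walks_inf_le M N J i :
  (forall j k, j != k -> M j k != 0 -> N j k != 0) -> ~ J i ->
  (ereal_inf [set ((size p)%:R%:E : \bar R) | p in walks N J i]%classic <=
   ereal_inf [set (size p)%:R%:E | p in walks M J i]%classic)%E.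
Proof.
move=> MN Ji; apply: le_ereal_inf_tmp => _ [p [_ Mp Jp] <-].
have [q [Nq lq sq]] := path_deloop MN Mp.
apply: (@le_trans _ _ (size q)%:R%:E); last by rewrite lee_fin ler_nat.
apply: ereal_inf_lbound; exists q => //; split=> //; last by rewrite lq.
(* An empty [q] would make [i] the last vertex and put it in [J]. *)
by move=> q0; apply: Ji; move: Jp; rewrite -lq q0.
Qed.

Lemma eq_walk_index M N J :
  (forall i j, i != j -> (M i j != 0) = (N i j != 0)) ->
  walk_index M J = walk_index N J.
Proof.
move=> MN; congr (maxe _ (ereal_sup _)); apply: eq_imagel => i Ji.
by apply/le_anti/andP; split; apply: walks_inf_le => // j k jk; rewrite MN.
Qed.

End WalkIndex.

Section Scaling.
Set Implicit Arguments.
Unset Strict Implicit.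
Variables (R : realType) (n : nat).
Implicit Types (A B D : 'M[R]_n).

Lemma mul_diag_mxE D A i j : is_diag_mx D -> (D *m A) i j = D i i * A i j.
Proof. by case/diag_mxP=> d ->; rewrite mul_diag_mx !mxE eqxx. Qed.

Lemma L0_row_sum A i : L0_matrix A ->
  \sum_j A i j = `|A i i| - \sum_(j | j != i) `|A i j|.
Proof.
case=> offA diagA; rewrite (bigD1 i) //= ger0_norm // -sumrN.
by congr (_ + _); apply: eq_bigr => j ji; rewrite ler0_norm ?opprK ?offA 1?eq_sym.
Qed.

(** A common form for both parts: row scaling by [d] turns [A] into the identity minus [B]. Part (a)
    takes for [d] the diagonal of [D], part (b) the inverses of its entries. *)
Variables (A B : 'M[R]_n) (d : 'I_n -> R).
Hypotheses (d_gt0 : forall i, 0 < d i)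
           (dAB : forall i j, d i * A i j = (i == j)%:R - B i j).

Lemma scaled_row_sum i : d i * (\sum_j A i j) = 1 - \sum_j B i j.
Proof.
rewrite mulr_sumr (eq_bigr _ (fun j _ => dAB i j)) sumrB; congr (_ - _).
rewrite (bigD1 i) //= eqxx big1 ?addr0 // => j ji.
by rewrite eq_sym (negPf ji).
Qed.

Hypothesis L0A : L0_matrix A.

(** A positive factor preserves signs, so this one identity settles both the weak inequalities
    ([wdd_row_sum]) and the strict ones ([Jsdd_Jhat]). *)
Lemma dominance_gap i :
  1 - \sum_j B i j = d i * (`|A i i| - \sum_(j | j != i) `|A i j|).
Proof. by rewrite -scaled_row_sum L0_row_sum. Qed.

Lemma wdd_row_sum : wdd A <-> forall i, \sum_j B i j <= 1.
Proof.
by split=> h i; move: (h i);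
  rewrite -[\sum_j B i j <= 1]subr_ge0 dominance_gap pmulr_rge0 // subr_ge0.
Qed.

Lemma Jsdd_Jhat : Jsdd A = Jhat B.
Proof.
by apply/seteqP; split=> i;
  rewrite /Jsdd /Jhat /= -[\sum_j B i j < 1]subr_gt0 dominance_gap pmulr_rgt0 //
          subr_gt0.
Qed.

Lemma con_con_hat : con A = con_hat B.
Proof.
rewrite /con /con_hat Jsdd_Jhat; apply: eq_walk_index => i j ij.
(* Off the diagonal [d i * A i j = - B i j] with [d i] positive, so both entries vanish together. *)
have := dAB i j; rewrite (negPf ij) sub0r => /(congr1 (fun x => x != 0)).
by rewrite oppr_eq0 mulf_eq0 gt_eqF.
Qed.

End Scaling.

Theorem lemma2p22 (R : realType) (n : nat) :
  (forall A D : 'M[R]_n,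
     wdd A -> L0_matrix A ->
     is_diag_mx D -> (forall i, 0 < D i i) ->
     (forall i, A i i != 0 -> D i i <= 1 / A i i) ->
     substochastic (1%:M - D *m A) /\
     con A = con_hat (1%:M - D *m A)) /\
  (forall B D : 'M[R]_n,
     substochastic B ->
     is_diag_mx D -> (forall i, 0 < D i i) ->
     wdd (D *m (1%:M - B)) /\ L0_matrix (D *m (1%:M - B)) /\
     con (D *m (1%:M - B)) = con_hat B).
Proof.
split=> [A D wA LA diagD D_gt0 D_le|B D [B_ge0 B_le1] diagD D_gt0].
  have BE i j : (1%:M - D *m A) i j = (i == j)%:R - D i i * A i j.
    by rewrite 2!mxE [X in _ + X]mxE mul_diag_mxE.
  have dAB i j : D i i * A i j = (i == j)%:R - (1%:M - D *m A) i j.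
    by rewrite BE opprB addrC subrK.
  split; last exact: con_con_hat D_gt0 dAB LA.
  split; last exact: (wdd_row_sum D_gt0 dAB LA).1.
  move=> i j; rewrite BE; have [<-|ij] := eqVneq i j.
    (* [D i i] is bounded above only when [A i i] is nonzero; if [A i i] is zero, the entry is 1. *)
    have [->|Aii] := eqVneq (A i i) 0; first by rewrite mulr0 subr0.
    by rewrite subr_ge0 -ler_pdivlMr ?D_le // lt_def Aii LA.2.
  by rewrite sub0r oppr_ge0 pmulr_rle0 ?LA.1.
have AE i j : (D *m (1%:M - B)) i j = D i i * ((i == j)%:R - B i j).
  by rewrite mul_diag_mxE // 3!mxE.
have d_gt0 i : 0 < (D i i)^-1 by rewrite invr_gt0.
have dAB i j : (D i i)^-1 * (D *m (1%:M - B)) i j = (i == j)%:R - B i j.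
  by rewrite AE mulKf // lt0r_neq0.
have LA : L0_matrix (D *m (1%:M - B)).
  split=> [i j ij|i]; rewrite AE.
    by rewrite (negPf ij) sub0r pmulr_rle0 ?oppr_le0.
  (* [B i i] is at most its row sum, the other entries being nonnegative. *)
  rewrite eqxx pmulr_rge0 // subr_ge0; apply: le_trans (B_le1 i).
  by rewrite (bigD1 i) //= lerDl sumr_ge0.
split; first exact: (wdd_row_sum d_gt0 dAB LA).2 B_le1.
by split=> //; exact: con_con_hat d_gt0 dAB LA.
Qed.
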